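(* Let $S$ be a semigroup, let $\sigma:S\to S$ be an involutive automorphism, and let $\alpha\in\mathbb{C}$ be a fixed constant. The solutions $g,f:S\to\mathbb{C}$ of the functional equation $$g(x\sigma(y))=g(x)g(y)-f(x)f(y)+\alpha f(x\sigma(y)),\quad x,y\in S,$$ are exactly the pairs in the following families: (1) $\alpha=\pm1$, $f$ is any non-zero function and $g=\alpha f$. (2) $\alpha\neq 1$, $f=g\neq 0$ and $g=0$ on $S^2$. (3) $\alpha\neq -1$, $f=-g\neq 0$ and $g=0$ on $S^2$. (4) $f=(q+\alpha)\dfrac{\chi}{2}$ and $g=\left(1\pm\sqrt{1+q^2-\alpha^2}\right)\dfrac{\chi}{2}$, where $q\in\mathbb{C}$ is a constant and $\chi:S\to\mathbb{C}$ is a non-zero even multiplicative function. (5) $f=\alpha\dfrac{\chi_1+\chi_2}{2}+q\dfrac{\chi_1-\chi_2}{2}$ and $g=\dfrac{\chi_1+\chi_2}{2}\pm\sqrt{1+q^2-\alpha^2}\,\dfrac{\chi_1-\chi_2}{2}$, where $\chi_1,\chi_2:S\to\mathbb{C}$ are two different non-zero even multiplicative functions and $q\in\mathbb{C}\setminus\{\pm\alpha\}$ is a constant. (6) $\alpha\neq 0$, $f=\alpha\chi_1$ and $g=\chi_2$, where $\chi_1,\chi_2:S\to\mathbb{C}$ are two different non-zero even multiplicative functions. (7) $f=\alpha\chi+h$ and $g=\chi\pm h$, where $\chi:S\to\mathbb{C}$ is a non-zero even multiplicative function and $h:S\to\mathbb{C}$ is an even solution of the special sine addition law $h(xy)=h(x)\chi(y)+h(y)\chi(x)$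 for all $x,y\in S$. (8) $\alpha\neq\pm1$, $f=\dfrac{1+\alpha}{2}\chi-\dfrac{1-\alpha}{2}\chi^*$ and $g=\dfrac{1+\alpha}{2}\chi+\dfrac{1-\alpha}{2}\chi^*$, where $\chi:S\to\mathbb{C}$ is a multiplicative function such that $\chi\neq\chi^*$. Off the exceptional case (1), $g$ and $f$ are abelian. Moreover, for any solution $(g,f)$: if $S$ is a topological semigroup and $f\in C(S)$ is such that $f\neq\alpha\chi$ for any multiplicative function $\chi\in C(S)$, then $g\in C(S)$.
   Context: An involutive automorphism of $S$ is a map $\sigma:S\to S$ with $\sigma(xy)=\sigma(x)\sigma(y)$ and $\sigma(\sigma(x))=x$ for all $x,y\in S$. A function $\chi:S\to\mathbb{C}$ is multiplicative if $\chi(xy)=\chi(x)\chi(y)$ for all $x,y\in S$. For $f:S\to\mathbb{C}$, $f^*(x)=f(\sigma(x))$; $f$ is even if $f=f^*$. $S^2=\{xy\mid x,y\in S\}$. A function $f:S\to\mathbb{C}$ is central if $f(xy)=f(yx)$ for all $x,y\in S$, and abelian if it is central and $f(xyz)=f(xzy)$ for all $x,y,z\in S$. For a topological semigroup $S$, $C(S)$ denotes the algebra of continuous functions from $S$ into $\mathbb{C}$. *)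

(* Defs.v *)
From HB Require Import structures.
From mathcomp Require Import all_boot all_order all_algebra.
From mathcomp Require Import complex.
From mathcomp Require Import all_classical all_reals all_analysis.
Import numFieldNormedType.Exports.
Import Order.TTheory GRing.Theory Num.Theory.

Set Implicit Arguments.
Unset Strict Implicit.
Unset Printing Implicit Defensive.

Local Open Scope ring_scope.

(* Packing R[i] as a numClosedFieldType gives access to the topology that
   MathComp-Analysis puts on every numClosedFieldType, namely the one induced
   by the norm `|z|, here the usual complex modulus. *)
Definition Cplx (R : realType) : numClosedFieldType := R[i]%C.

HB.mixin Record Semigroup_isTopSemigroup S of Semigroup S & Topological S := {
  mulg_continuous : continuous (fun p : S * S => (p.1 * p.2)%g)
}.

#[short(type="topSemigroupType")]
HB.structure Definition TopSemigroup :=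
  {S of Semigroup S & Topological S & Semigroup_isTopSemigroup S}.

Definition involutive_automorphism (S : semigroupType) (sigma : S -> S) :=
  {morph sigma : x y / (x * y)%g} /\ involutive sigma.

Section Functions.
Variables (C : numClosedFieldType) (S : semigroupType).
Implicit Types (f g h chi : S -> C) (sigma : S -> S) (alpha q : C).

Definition nonzero f := f <> (fun=> 0).

(* The zero function is allowed. *)
Definition multiplicative_fun chi := forall x y, chi (x * y)%g = chi x * chi y.

Definition star sigma f : S -> C := fun x => f (sigma x).

Definition even sigma f := f = star sigma f.

Definition central f := forall x y, f (x * y)%g = f (y * x)%g.

Definition abelian_fun f :=
  central f /\ forall x y z, f (x * y * z)%g = f (x * z * y)%g.

Definition vanishes_on_S2 f := forall x y, f (x * y)%g = 0.

Definition even_character sigma chi :=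
  [/\ nonzero chi, even sigma chi & multiplicative_fun chi].

Definition special_sine_law chi h :=
  forall x y, h (x * y)%g = h x * chi y + h y * chi x.

Definition solution sigma alpha g f :=
  forall x y,
    g (x * sigma y)%g = g x * g y - f x * f y + alpha * f (x * sigma y)%g.

Definition exceptional_family alpha g f :=
  [/\ alpha = 1 \/ alpha = -1,
      nonzero f
    & forall x, g x = alpha * f x].

Definition equal_family alpha g f :=
  [/\ alpha <> 1, f = g, nonzero g & vanishes_on_S2 g].

Definition opposite_family alpha g f :=
  [/\ alpha <> -1, forall x, f x = - g x, nonzero g & vanishes_on_S2 g].

Definition one_character_family sigma alpha g f :=
  exists q chi,
    let s := sqrtC (1 + q ^+ 2 - alpha ^+ 2) in
    [/\ even_character sigma chi,
        forall x, f x = (q + alpha) * (chi x / 2)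
      & (forall x, g x = (1 + s) * (chi x / 2)) \/
        (forall x, g x = (1 - s) * (chi x / 2))].

Definition two_character_family sigma alpha g f :=
  exists q chi1 chi2,
    let s := sqrtC (1 + q ^+ 2 - alpha ^+ 2) in
    [/\ even_character sigma chi1 /\ even_character sigma chi2,
        chi1 <> chi2,
        q <> alpha /\ q <> - alpha,
        forall x, f x = alpha * ((chi1 x + chi2 x) / 2)
                        + q * ((chi1 x - chi2 x) / 2)
      & (forall x, g x = (chi1 x + chi2 x) / 2 + s * ((chi1 x - chi2 x) / 2)) \/
        (forall x, g x = (chi1 x + chi2 x) / 2 - s * ((chi1 x - chi2 x) / 2))].

Definition separate_character_family sigma alpha g f :=
  exists chi1 chi2,
    [/\ alpha <> 0,
        even_character sigma chi1 /\ even_character sigma chi2,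
        chi1 <> chi2,
        forall x, f x = alpha * chi1 x
      & g = chi2].

Definition sine_family sigma alpha g f :=
  exists chi h,
    [/\ even_character sigma chi,
        even sigma h /\ special_sine_law chi h,
        forall x, f x = alpha * chi x + h x
      & (forall x, g x = chi x + h x) \/ (forall x, g x = chi x - h x)].

Definition conjugate_character_family sigma alpha g f :=
  exists chi,
    [/\ alpha <> 1 /\ alpha <> -1,
        multiplicative_fun chi,
        chi <> star sigma chi,
        forall x, f x = (1 + alpha) / 2 * chi x - (1 - alpha) / 2 * star sigma chi x
      & forall x, g x = (1 + alpha) / 2 * chi x + (1 - alpha) / 2 * star sigma chi x].

Definition regular_family sigma alpha g f :=
  equal_family alpha g f \/
  opposite_family alpha g f \/
  one_character_family sigma alpha g f \/
  two_character_family sigma alpha g f \/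
  separate_character_family sigma alpha g f \/
  sine_family sigma alpha g f \/
  conjugate_character_family sigma alpha g f.

End Functions.

(* Main.v *)
Require Import Defs.
From mathcomp Require Import all_boot all_order all_algebra.
From mathcomp Require Import complex.
From mathcomp Require Import all_classical all_reals all_analysis.
From mathcomp Require Import ring.
Import numFieldNormedType.Exports.
Import Order.TTheory GRing.Theory Num.Theory.

(** Put phi = (g, f) : S -> C^2, let B be the symmetric bilinear form
    B(u, v) = u_1 v_1 - u_2 v_2 on C^2, and e = (1, alpha).  The equation says
      B(e, phi (x sigma(y))) = B(phi x, phi y).

    If g and f are proportional, it is a scalar equation for one function w,
    c w(x sigma(y)) = d w(x) w(y), and it is settled by whether c and d vanish
    (lemma dependent_classified).

    If they are linearly independent, then phi spans C^2.  Associativity and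
    the non-degeneracy of B then turn left translation by y into a matrix N y,
    with phi (y z) = N y phi z and phi y = N y e, so that N is a matrix
    representation of S with cyclic vector e (lemma span_representation).
    Right translations act through matrices K y, the B-adjoints of the
    matrices N (sigma y), and commute with all the N x.  The K y cannot all be
    scalar, since then the N y would be scalar and phi would stay on the line
    of e.  A 2 x 2 matrix commuting with a non-scalar one is a polynomial in
    it, hence N x = chi x + h x J with a fixed singular J satisfying
    J^2 = mu J.  Multiplicativity of N makes chi multiplicative and gives
      h (x y) = h x chi y + chi x h y + mu h x h y,
    while phi = N e expresses g and f through chi and h
    (lemma independent_solution).  When mu = 0 this is the special sine law;
    when mu is non-zero, chi + mu h is a second multiplicative function, and g
    and f are combinations of two multiplicative functions.

    Feeding these forms back into the equation and comparing coefficients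
    determines how sigma acts: it fixes chi and h in the first case
    (lemma sine_classified), and in the second case it either fixes both
    multiplicative functions or exchanges them
    (lemma two_characters_classified).

    For continuity, f (x y) as a function of x lies in the span of the
    components of f, so that each multiplicative component of f is a linear
    combination of f and a right translate of f. *)

Set Implicit Arguments.
Unset Strict Implicit.
Unset Printing Implicit Defensive.

Local Open Scope ring_scope.

(** * Spanning solutions of a bilinear equation *)

Section SpanningEquation.
Variables (F : fieldType) (S : semigroupType) (n : nat) (sigma : S -> S).
Variables (D : 'M[F]_n) (e : 'cV[F]_n) (phi : S -> 'cV[F]_n) (z : 'I_n -> S).
Hypotheses (sigma_auto : involutive_automorphism sigma).
Hypotheses (D_sym : D^T = D) (D_unit : D \in unitmx).
Hypothesis phi_span : \matrix_(i, j) phi (z j) i 0 \in unitmx.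
Hypothesis phi_eq : forall x y,
  e^T *m D *m phi (x * sigma y)%g = (phi x)^T *m D *m phi y.

Lemma span_eq m (A B : 'M[F]_(m, n)) :
  (forall x, A *m phi x = B *m phi x) -> A = B.
Proof.
move=> AB; apply: (can_inj (mulmxK phi_span)); apply/matrixP => i j.
have := congr1 (fun M : 'cV[F]_m => M i 0) (AB (z j)).
rewrite !mxE => AB_ij.
under eq_bigr do rewrite [X in _ * X]mxE.
by under [in RHS]eq_bigr do rewrite [X in _ * X]mxE.
Qed.

Lemma span_eq_tr m (A B : 'M[F]_(n, m)) :
  (forall x, (phi x)^T *m D *m A = (phi x)^T *m D *m B) -> A = B.
Proof.
move=> AB; apply: (can_inj (mulKmx D_unit)); apply: trmx_inj.
apply: span_eq => x; apply: trmx_inj.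
by rewrite [LHS]trmx_mul [RHS]trmx_mul !trmxK !mulmxA AB.
Qed.

(** Both sides of eq3 below equal the value of the linear form at
    x sigma(y) sigma(w), bracketed in two ways; since phi spans, this makes
    phi (y w) depend linearly on phi w, through N y.  The last clause, which
    holds because K x is the adjoint of N (sigma x) for the form D, transports
    the failure of N to be scalar to K. *)
Lemma span_representation : exists N K : S -> 'M[F]_n,
  [/\ forall x y, N (x * y)%g = N x *m N y,
      forall x, phi x = N x *m e,
      forall x y, N x *m K y = K y *m N x
    & forall x a, K x = a%:M -> N (sigma x) = a%:M].
Proof.
have [sM sK] := sigma_auto.
pose Z := \matrix_(i, j) phi (z j) i 0.
have [N NE] : exists N : S -> 'M[F]_n, forall y,
    N y = (\matrix_(i, j) phi (y * z j)%g i 0) *m invmx Z by eexists.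
have eq3 x y w : (phi (x * sigma y)%g)^T *m D *m phi w
               = (phi x)^T *m D *m phi (y * w)%g.
  rewrite -!phi_eq; congr (_ *m phi _).
  by rewrite -mulgA -[in RHS](sK w) -sM ?sK.
(* It suffices to test on the basis phi (z j), where N y is defined by its
   effect. *)
have phi_right x y : (phi (x * sigma y)%g)^T *m D = (phi x)^T *m D *m N y.
  rewrite NE mulmxA; apply: (canRL (mulmxK phi_span)); apply/matrixP => i j.
  have := congr1 (fun M : 'M[F]_1 => M i 0) (eq3 x y (z j)).
  rewrite !mxE => h; under eq_bigr do rewrite [X in _ * X]mxE.
  by under [in RHS]eq_bigr do rewrite [X in _ * X]mxE.
have phi_left y w : phi (y * w)%g = N y *m phi w.
  by apply: span_eq_tr => x; rewrite mulmxA -phi_right eq3.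
have phiE y : phi y = N y *m e.
  apply: span_eq_tr => x; rewrite mulmxA -phi_right -phi_eq.
  rewrite [RHS]mx11_scalar -tr_scalar_mx -mx11_scalar.
  by rewrite !trmx_mul trmxK D_sym mulmxA.
have [K KE] : exists K : S -> 'M[F]_n, forall y,
    K y = invmx D *m (N (sigma y))^T *m D by eexists.
have phi_rightK x y : phi (x * y)%g = K y *m phi x.
  have := phi_right x (sigma y); rewrite sK => /(congr1 trmx).
  rewrite [LHS]trmx_mul [RHS]trmx_mul (trmx_mul _ D) !trmxK D_sym => h.
  by rewrite -[LHS](mulKmx D_unit) h KE !mulmxA.
exists N, K; split=> // [x y|x y|x a Kx].
- by apply: span_eq => w; rewrite -mulmxA -!phi_left mulgA.
- apply: span_eq => w.
  by rewrite -!mulmxA -phi_left -!phi_rightK -phi_left mulgA.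
- apply: trmx_inj; rewrite tr_scalar_mx.
  apply: (can_inj (mulmxK D_unit)).
  by rewrite -[LHS](mulKVmx D_unit) (mulmxA (invmx D)) -KE Kx scalar_mxC.
Qed.
End SpanningEquation.

(** * Two by two matrices *)

(** This lets the ring tactic close an equation a = b that follows from an
    equation c = d whose sides are not monomials. *)
Lemma eq_by_sub (V : zmodType) (a b c d : V) : c = d -> a - b = c - d -> a = b.
Proof. by move=> -> /eqP; rewrite subrr subr_eq0 => /eqP. Qed.

Section TwoByTwo.
Variable F : fieldType.
Implicit Types A B T : 'M[F]_2.

Lemma mx2P A B : A 0 0 = B 0 0 -> A 0 1 = B 0 1 -> A 1 0 = B 1 0 ->
  A 1 1 = B 1 1 -> A = B.
Proof.
move=> *; apply/matrixP => i j.
have ord2 (k : 'I_2) : k = 0 \/ k = 1.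
  by case: k => [[|[|k]] kP] //; [left|right]; apply: val_inj.
by case: (ord2 i) => ->; case: (ord2 j) => ->.
Qed.

Lemma mulmx2E n (A : 'M[F]_(n, 2)) m (B : 'M[F]_(2, m)) i j :
  (A *m B) i j = A i 0 * B 0 j + A i 1 * B 1 j.
Proof.
by rewrite mxE !big_ord_recl big_ord0 addr0; congr (_ + A i _ * B _ j);
  apply: val_inj.
Qed.

Lemma unitmx2 A : A 0 0 * A 1 1 - A 0 1 * A 1 0 != 0 -> A \in unitmx.
Proof.
move=> d0; pose B : 'M[F]_2 := \matrix_(i, j)
  ((if i == j then if i == 0 then A 1 1 else A 0 0 else - A i j)
   / (A 0 0 * A 1 1 - A 0 1 * A 1 0)).
suff /mulmx1_unit[] : A *m B = 1%:M by [].
by apply: mx2P; rewrite mulmx2E !mxE /=; field.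
Qed.

(** The entries of A T = T A force the off-diagonal part and the difference of
    the diagonal entries of A to be proportional to those of T; any one of
    these three data that is non-zero in T gives the factor. *)
Lemma comm_nonscalar_mx2 T A : (forall a, T <> a%:M) -> A *m T = T *m A ->
  exists c, A = c.1%:M + c.2 *: T.
Proof.
move=> Tns AT.
have E i j : A i 0 * T 0 j + A i 1 * T 1 j = T i 0 * A 0 j + T i 1 * A 1 j.
  by rewrite -!mulmx2E AT.
have := E 0 0; have := E 0 1; have := E 1 0; have := E 1 1.
have [T01|T01] := eqVneq (T 0 1) 0; last first.
  move=> E11 E10 E01 E00; exists (A 0 0 - A 0 1 / T 0 1 * T 0 0, A 0 1 / T 0 1).
  apply: mx2P; rewrite !mxE /=; try by field.
  - rewrite (_ : A 1 0 = A 0 1 * T 1 0 / T 0 1); first by field.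
    by apply: (mulIf T01); rewrite divfK//; apply: (eq_by_sub (esym E00)); ring.
  - rewrite (_ : A 1 1 = (A 0 0 * T 0 1 + A 0 1 * T 1 1 - T 0 0 * A 0 1) / T 0 1).
      by field.
    by apply: (mulIf T01); rewrite divfK//; apply: (eq_by_sub (esym E01)); ring.
have [T10|T10] := eqVneq (T 1 0) 0; last first.
  move=> E11 E10 E01 E00; exists (A 0 0 - A 1 0 / T 1 0 * T 0 0, A 1 0 / T 1 0).
  apply: mx2P; rewrite !mxE /= ?T01; try by field.
  - rewrite (_ : A 0 1 = 0); first by field.
    by apply: (mulIf T10); rewrite ?T01 in E00 *; apply: (eq_by_sub E00); ring.
  - rewrite (_ : A 1 1 = (A 0 0 * T 1 0 - A 1 0 * T 0 0 + T 1 1 * A 1 0) / T 1 0).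
      by field.
    by apply: (mulIf T10); rewrite divfK//; apply: (eq_by_sub E10); ring.
rewrite T01 T10 => E11 E10 E01 E00.
have T0011 : T 0 0 - T 1 1 != 0.
  apply/eqP => /eqP; rewrite subr_eq0 => /eqP TT; apply: (Tns (T 0 0)).
  by apply: mx2P; rewrite !mxE /= ?T01 ?T10 ?mulr0n ?mulr1n // TT.
exists (A 0 0 - (A 0 0 - A 1 1) / (T 0 0 - T 1 1) * T 0 0,
        (A 0 0 - A 1 1) / (T 0 0 - T 1 1)).
apply: mx2P; rewrite !mxE /= ?T01 ?T10; try by field.
- rewrite (_ : A 0 1 = 0); first by field.
  by apply: (mulIf T0011); apply: (eq_by_sub (esym E01)); ring.
- rewrite (_ : A 1 0 = 0); first by field.
  by apply: (mulIf T0011); apply: (eq_by_sub E10); ring.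
Qed.

End TwoByTwo.

(** With a an eigenvalue of T, this is the Cayley-Hamilton identity for the
    singular matrix T - a, whose trace is mu. *)
Lemma shift_to_singular_mx2 (F : closedFieldType) (T : 'M[F]_2) :
  exists a mu, (T - a%:M) *m (T - a%:M) = mu *: (T - a%:M).
Proof.
have [a] := solve_monicpoly (fun i => if i == 0%N then
  T 0 1 * T 1 0 - T 0 0 * T 1 1 else T 0 0 + T 1 1) (isT : (0 < 2)%N).
rewrite !big_ord_recl big_ord0 /= expr0 expr1 mulr1 addr0 => a2.
exists a, (T 0 0 + T 1 1 - a *+ 2).
by apply: mx2P; rewrite mulmx2E !mxE /=;
  first [ring | apply: (eq_by_sub (esym a2)); ring].
Qed.

(** * Linear independence of two functions *)

(** A non-vanishing 2 x 2 minor, which is how independence is used. *)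
Definition lin_indep (F : fieldType) (T : Type) (u v : T -> F) :=
  exists x y, u x * v y != u y * v x.

Section LinearIndependence.
Variables (F : fieldType) (T : Type).
Implicit Types u v : T -> F.

Lemma lin_indep_coef u v a b a' b' : lin_indep u v ->
  (forall x, a * u x + b * v x = a' * u x + b' * v x) -> a = a' /\ b = b'.
Proof.
move=> [x [y]]; rewrite -subr_eq0 => uv E; have Ex := E x; have Ey := E y.
split; apply/eqP; rewrite -subr_eq0; apply/eqP; apply: (mulIf uv).
- transitivity ((a * u x + b * v x - (a' * u x + b' * v x)) * v y
    - (a * u y + b * v y - (a' * u y + b' * v y)) * v x); first by ring.
  by rewrite Ex Ey; ring.
- transitivity ((a * u y + b * v y - (a' * u y + b' * v y)) * u x
    - (a * u x + b * v x - (a' * u x + b' * v x)) * u y); first by ring.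
  by rewrite Ex Ey; ring.
Qed.

Lemma lin_indep_comb g f u v a b c d : lin_indep g f ->
    (forall x, g x = a * u x + b * v x) -> (forall x, f x = c * u x + d * v x) ->
  lin_indep u v /\ a * d - b * c != 0.
Proof.
move=> [x [y]] + gE fE; rewrite -subr_eq0 !gE !fE.
rewrite (_ : _ - _ = (a * d - b * c) * (u x * v y - u y * v x)); last by ring.
by rewrite mulf_eq0 negb_or => /andP[? ?]; split=> //; exists x, y;
  rewrite -subr_eq0.
Qed.

Lemma lin_indep_neq0 u v : lin_indep u v -> exists x, v x != 0.
Proof.
move=> [x [y]]; have [->|vx _] := eqVneq (v x) 0; last by exists x.
rewrite mulr0; have [->|vy _] := eqVneq (v y) 0; last by exists y.
by rewrite mulr0 eqxx.
Qed.

Lemma lin_indepC u v : lin_indep u v -> lin_indep v u.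
Proof. by move=> [x [y uv]]; exists y, x; rewrite mulrC [X in _ != X]mulrC. Qed.

Lemma lin_dep_scalar u v : ~ lin_indep u v ->
  exists w a b, (forall x, u x = a * w x) /\ (forall x, v x = b * w x).
Proof.
move=> dep; have uv x y : u x * v y = u y * v x.
  by apply/eqP/negPn/negP => xy; apply: dep; exists x, y.
have [[x0 ux0]|] := pselect (exists x, u x != 0).
  exists u, 1, (v x0 / u x0); split=> x; first by rewrite mul1r.
  by apply: (mulfI ux0); rewrite uv; field.
move=> /forallNP u0; exists v, 0, 1; split=> x; last by rewrite mul1r.
by rewrite mul0r; apply/eqP/negPn/negP/u0.
Qed.

End LinearIndependence.

(** * Solving the equation *)

(** Both multiplicative functions and sine functions are covered: chi + mu h
    is again multiplicative, and for mu = 0 the law is the special sine law. *)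
Lemma independent_solution (C : numClosedFieldType) (S : semigroupType)
    (sigma : S -> S) (alpha : C) (g f : S -> C) :
  involutive_automorphism sigma -> solution sigma alpha g f ->
  lin_indep g f ->
  exists chi h mu a b,
    [/\ multiplicative_fun chi,
        forall x y, h (x * y)%g = h x * chi y + chi x * h y + mu * (h x * h y),
        forall x, g x = chi x + a * h x
      & forall x, f x = alpha * chi x + b * h x].
Proof.
move=> sigma_auto gf_sol [z1 [z2]]; rewrite -subr_eq0 => z_indep.
pose vec (u v : C) : 'cV[C]_2 := \col_i (if i == 0 then u else v).
pose D : 'M[C]_2 := \matrix_(i, j) (if i == j then if i == 0 then 1 else -1 else 0).
pose e := vec 1 alpha; pose phi x := vec (g x) (f x).
pose z (i : 'I_2) := if i == 0 then z1 else z2.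
have D_sym : D^T = D by apply: mx2P; rewrite !mxE.
have D_unit : D \in unitmx.
  by apply: unitmx2; rewrite !mxE /= mulr0 subr0 mul1r oppr_eq0 oner_eq0.
have phi_span : \matrix_(i, j) phi (z j) i 0 \in unitmx.
  by apply: unitmx2; rewrite !mxE /=.
have DE u v u' v' : (vec u v)^T *m D *m vec u' v' = (u * u' - v * v')%:M.
  apply/matrixP => i j; rewrite !ord1 !mulmx2E !mxE /=; ring.
have phi_eq x y : e^T *m D *m phi (x * sigma y)%g = (phi x)^T *m D *m phi y.
  by rewrite !DE gf_sol; congr _%:M; ring.
have [N [K [NM phiE NK KN]]] :=
  span_representation sigma_auto D_sym D_unit phi_span phi_eq.
(* Otherwise N would be scalar and phi y = N y e would stay on the line of e. *)
have [y0 Ky0] : exists y0, forall a, K y0 <> a%:M.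
  apply/not_existsP => allK; move: z_indep; apply/negP; rewrite negbK.
  have Nscalar x : exists a, N x = a%:M.
    have := allK (sigma x) => /existsNP[a /contrapT /KN].
    by rewrite (sigma_auto.2 x) => Nx; exists a.
  have phi_line x : exists a, g x = a /\ f x = a * alpha.
    have [a Nx] := Nscalar x; have := phiE x; rewrite Nx mul_scalar_mx => E.
    exists a; have := congr1 (fun M : 'cV[C]_2 => M 0 0) E.
    have := congr1 (fun M : 'cV[C]_2 => M 1 0) E.
    by rewrite !mxE /= mulr1.
  have [a [-> ->]] := phi_line z1; have [b [-> ->]] := phi_line z2.
  by apply/eqP; ring.
have [a [mu JJ]] := shift_to_singular_mx2 (K y0).
set J := K y0 - a%:M in JJ.
have J_nonscalar c : J <> c%:M.
  by move=> /(canRL (subrK _)); rewrite -raddfD /=; apply: Ky0.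
have NJ x : N x *m J = J *m N x.
  by rewrite mulmxBr mulmxBl NK scalar_mxC.
have /choice[c NE] x := comm_nonscalar_mx2 J_nonscalar (NJ x).
have coef_inj u v u' v' : u%:M + v *: J = u'%:M + v' *: J -> u = u' /\ v = v'.
  move=> E; have E' : (v - v') *: J = (u' - u)%:M.
    rewrite scalerBl (raddfB (@scalar_mx C 2)); apply: (eq_by_sub E).
    by rewrite opprB opprD [RHS]addrACA addrC.
  have [vv|vv] := eqVneq v v'.
    by split=> //; move: E; rewrite vv => /addIr /matrixP/(_ 0 0); rewrite !mxE.
  case: (J_nonscalar ((u' - u) / (v - v'))).
  move: vv; rewrite -subr_eq0 => vv.
  by apply: (scalerI vv); rewrite E' scale_scalar_mx mulrC divfK.
(* Since phi x = N x e, the coefficients of h in g and f are the coordinates of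
   J e. *)
exists (fun x => (c x).1), (fun x => (c x).2), mu, ((J *m e) 0 0), ((J *m e) 1 0).
have law x y : (c (x * y)%g).1 = (c x).1 * (c y).1 /\
  (c (x * y)%g).2 = (c x).2 * (c y).1 + (c x).1 * (c y).2 + mu * ((c x).2 * (c y).2).
  apply: coef_inj; rewrite -NE NM !NE mulmxDl !mulmxDr -!scalemxAl -!scalemxAr.
  rewrite JJ !mul_scalar_mx mul_mx_scalar scale_scalar_mx !scalerA.
  by rewrite -!addrA -!scalerDl; congr (_ + _ *: J); ring.
have phi_coef x i : phi x i 0 = (c x).1 * e i 0 + (c x).2 * (J *m e) i 0.
  by rewrite phiE NE mulmxDl mul_scalar_mx -scalemxAl !mxE.
split=> [x y|x y|x|x].
- by have [] := law x y.
- by have [] := law x y.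
- by have := phi_coef x 0; rewrite !mxE /= => ->; ring.
- by have := phi_coef x 1; rewrite !mxE /= => ->; ring.
Qed.

Section Classification.
Variables (C : numClosedFieldType) (S : semigroupType) (sigma : S -> S).
Hypothesis sigma_auto : involutive_automorphism sigma.
Implicit Types (f g h chi psi : S -> C) (alpha : C).

Lemma star_multiplicative chi :
  multiplicative_fun chi -> multiplicative_fun (star sigma chi).
Proof. by move=> chiM x y; rewrite /star sigma_auto.1 chiM. Qed.

Lemma sqr_sqrtC (s d : C) : s ^+ 2 = d -> s = sqrtC d \/ s = - sqrtC d.
Proof.
by move=> sd; have/eqP := esym sd; rewrite -{1}(sqrtCK d) eq_sym eqf_sqr =>
  /orP[]/eqP; [left|right].
Qed.

(** Independence of characters: comparing coefficients in the multiplicativity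
    of s chi1 + t chi2 leaves no room for a mixed term. *)
Lemma multiplicative_comb chi1 chi2 psi s t :
    lin_indep chi1 chi2 ->
    multiplicative_fun chi1 -> multiplicative_fun chi2 ->
    multiplicative_fun psi -> (forall x, psi x = s * chi1 x + t * chi2 x) ->
  s * t = 0.
Proof.
move=> indep M1 M2 M psiE.
have E y : s * chi1 y = s * s * chi1 y + s * t * chi2 y.
  suff [] : s * chi1 y = s * psi y /\ t * chi2 y = t * psi y.
    by move=> -> _; rewrite psiE; ring.
  apply: (lin_indep_coef indep) => x.
  by have := M x y; rewrite !psiE M1 M2 => E; apply: (eq_by_sub E); ring.
have [x|_ st0] := @lin_indep_coef _ _ _ _ s 0 (s * s) (s * t) indep.
  by rewrite mul0r addr0 E.
by rewrite -st0.
Qed.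

(** The numbers Bij are the values of the form B on the coefficient vectors
    (a, b) and (1 - a, alpha - b), whose sum is (1, alpha).  Comparing
    coefficients gives (B11 + B12) chi1(sigma x) = B11 chi1(x) + B12 chi2(x), so
    by independence of characters B11 or B12 vanishes:
    in the first case sigma exchanges the two functions and both vectors are
    isotropic, in the second it fixes both functions and the vectors are
    orthogonal.  Orthogonality is the quadratic relation sqE between a and
    q = 2 b - alpha. *)
Lemma two_characters_classified alpha g f chi1 chi2 a b :
    solution sigma alpha g f -> lin_indep g f ->
    multiplicative_fun chi1 -> multiplicative_fun chi2 ->
    (forall x, g x = a * chi1 x + (1 - a) * chi2 x) ->
    (forall x, f x = b * chi1 x + (alpha - b) * chi2 x) ->
  regular_family sigma alpha g f.
Proof.
move=> sol gf_indep M1 M2 gE fE.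
have [indep det0] := lin_indep_comb gf_indep gE fE.
have chi12 : chi1 <> chi2.
  by move=> chi_eq; case: indep => x [y]; rewrite chi_eq mulrC eqxx.
have [x1 x1P] := lin_indep_neq0 (lin_indepC indep).
have [x2 x2P] := lin_indep_neq0 indep.
pose B11 := a ^+ 2 - b ^+ 2; pose B12 := a * (1 - a) - b * (alpha - b).
pose B22 := (1 - a) ^+ 2 - (alpha - b) ^+ 2.
have B_det : B11 * B22 - B12 ^+ 2 != 0.
  rewrite (_ : _ - _ = - (a * (alpha - b) - (1 - a) * b) ^+ 2).
    by rewrite oppr_eq0 expf_eq0.
  by rewrite /B11 /B12 /B22; ring.
have coefs y : (B11 + B12) * star sigma chi1 y = B11 * chi1 y + B12 * chi2 y /\
               (B12 + B22) * star sigma chi2 y = B12 * chi1 y + B22 * chi2 y.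
  apply: (lin_indep_coef indep) => x; have := sol x y.
  rewrite !gE !fE !M1 !M2 /star => E; apply: (eq_by_sub E).
  by rewrite /B11 /B12 /B22; ring.
(* If B11 + B12 = 0, then B11 = B12 = 0 and the form would be degenerate. *)
have l1 : B11 + B12 != 0.
  apply: contra_neq B_det => l1.
  have [x|B11_0 B12_0] := @lin_indep_coef _ _ _ _ 0 0 B11 B12 indep.
    by have [<- _] := coefs x; rewrite l1; ring.
  by rewrite -B11_0 -B12_0; ring.
have star1E x : star sigma chi1 x
    = B11 / (B11 + B12) * chi1 x + B12 / (B11 + B12) * chi2 x.
  by apply: (mulfI l1); rewrite (coefs x).1; field.
have /eqP := multiplicative_comb indep M1 M2 (star_multiplicative M1) star1E.
rewrite !mulf_eq0 invr_eq0 (negbTE l1) !orbF => /orP[/eqP B11_0|/eqP B12_0].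
- have chi12_star : chi2 = star sigma chi1.
    apply/funext => x; move: (coefs x).1 l1; rewrite B11_0 add0r mul0r add0r.
    by move=> E /mulfI; apply; rewrite E.
  have B22_0 : B22 = 0.
    have [x|//] := @lin_indep_coef _ _ _ _ B22 0 0 B22 indep.
    have := (coefs x).2; rewrite {1}chi12_star /star sigma_auto.2.
    by move=> E; apply: (eq_by_sub E); ring.
  do 6!right.
  have a_neq0 : a != 0.
    apply: contra_neq det0 => a0; have : b ^+ 2 = 0.
      by apply: (eq_by_sub (esym B11_0)); rewrite /B11 a0; ring.
    by move=> /eqP; rewrite expf_eq0 /= a0 => /eqP->; ring.
  have a_neq1 : 1 - a != 0.
    apply: contra_neq det0 => a1; have : (alpha - b) ^+ 2 = 0.
      by apply: (eq_by_sub (esym B22_0)); rewrite /B22 a1; ring.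
    by move=> /eqP; rewrite expf_eq0 /= a1 => /eqP->; ring.
  have neq2 (t : C) : t != 0 -> t *+ 2 != 0 by rewrite mulrn_eq0.
  (* Both vectors lie on the lines of (1, 1) and (1, -1); they cannot lie on the
     same one, and the two remaining choices differ by exchanging chi1 and
     chi2. *)
  move/eqP: B11_0; move/eqP: B22_0; rewrite !subr_eq0 !eqf_sqr.
  move=> /orP[]/eqP E1 /orP[]/eqP E2.
  + by move: det0; rewrite -E1 E2 mulrC subrr eqxx.
  + have aE : alpha = 1 - a *+ 2.
      by apply: (eq_by_sub (esym E1)); rewrite E2; ring.
    have bE : b = - a by rewrite E2 opprK.
    exists chi2; have star2 x : star sigma chi2 x = chi1 x.
      by rewrite chi12_star /star sigma_auto.2.
    split=> // [|E|x|x].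
    * split=> E.
        by move/eqP: (neq2 _ a_neq0); apply; apply: (eq_by_sub (etrans (esym E) aE));
          ring.
      by move/eqP: (neq2 _ a_neq1); apply; apply: (eq_by_sub (esym (etrans (esym E) aE)));
        ring.
    * by apply: chi12; apply/funext => x; rewrite -star2 -E.
    * by rewrite star2 fE bE aE; field.
    * by rewrite star2 gE aE; field.
  + have aE : alpha = a *+ 2 - 1.
      by apply: (eq_by_sub E1); rewrite E2; ring.
    exists chi1; rewrite -chi12_star.
    split=> // [|x|x].
    * split=> E.
        by move/eqP: (neq2 _ a_neq1); apply; apply: (eq_by_sub (etrans (esym E) aE));
          ring.
      by move/eqP: (neq2 _ a_neq0); apply; apply: (eq_by_sub (esym (etrans (esym E) aE)));
        ring.
    * by rewrite fE -E2 aE; field.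
    * by rewrite gE aE; field.
  + by move/eqP: det0; case; rewrite E1 E2; ring.
have B11_neq0 : B11 != 0 by move: l1; rewrite B12_0 addr0.
have B22_neq0 : B22 != 0.
  by move: B_det; rewrite B12_0 expr0n subr0 mulf_eq0 negb_or => /andP[].
have even1 : even sigma chi1.
  apply/funext => x; apply: (mulfI B11_neq0).
  by have := (coefs x).1; rewrite B12_0; rewrite addr0 mul0r addr0 => ->.
have even2 : even sigma chi2.
  apply/funext => x; apply: (mulfI B22_neq0).
  by have := (coefs x).2; rewrite B12_0 !add0r mul0r add0r => ->.
have nonzeroP chi x : chi x != 0 -> nonzero chi.
  by move=> /eqP chix chi0; apply: chix; rewrite chi0.
have char1 : even_character sigma chi1 by split=> //; apply: (nonzeroP _ x1).
have char2 : even_character sigma chi2 by split=> //; apply: (nonzeroP _ x2).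
pose q := b *+ 2 - alpha.
have sqE : (a *+ 2 - 1) ^+ 2 = 1 + q ^+ 2 - alpha ^+ 2.
  apply: (eq_by_sub (esym (congr1 (fun t => t *+ 4) B12_0))).
  by rewrite /q /B12; ring.
(* For q = alpha or q = - alpha the coefficients degenerate to the separate
   form, with chi1 and chi2 in this order or in the opposite one. *)
have a01 : q ^+ 2 = alpha ^+ 2 -> a = 0 \/ a = 1.
  move=> q2; have /eqP : a * (1 - a) = 0.
    apply: (mulfI (_ : 4 != 0)); first by rewrite pnatr_eq0.
    by apply: (eq_by_sub (esym sqE)); rewrite q2; ring.
  by rewrite mulf_eq0 subr_eq0 => /orP[]/eqP; [left|right].
have [qa|qa] := eqVneq q alpha.
  have bE : b = alpha.
    apply: (mulfI (_ : 2 != 0)); first by rewrite pnatr_eq0.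
    by apply: (eq_by_sub qa); rewrite /q; ring.
  have [a0|a1] := a01 (congr1 (fun t => t ^+ 2) qa); last first.
    by move: det0; rewrite a1 bE !subrr mulr0 mul0r subrr eqxx.
  do 4!right; left; exists chi1, chi2; split=> //.
  - by move=> alpha0; move: det0; rewrite a0 bE alpha0 mul0r mulr0 subrr eqxx.
  - by move=> x; rewrite fE bE; ring.
  - by apply/funext => x; rewrite gE a0; ring.
have [qN|qN] := eqVneq q (- alpha).
  have bE : b = 0.
    apply: (mulfI (_ : 2 != 0)); first by rewrite pnatr_eq0.
    by apply: (eq_by_sub qN); rewrite /q; ring.
  have [|a0|a1] := a01; first by rewrite qN sqrrN.
    by move: det0; rewrite a0 bE mul0r mulr0 subrr eqxx.
  do 4!right; left; exists chi2, chi1; split=> //.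
  - by move=> alpha0; move: det0; rewrite a1 bE alpha0 !subr0 mulr0 mulr0 subrr eqxx.
  - exact/nesym.
  - by move=> x; rewrite fE bE; ring.
  - by apply/funext => x; rewrite gE a1; ring.
do 3!right; left; exists q, chi1, chi2; split=> //.
- by split; apply/eqP.
- by move=> x; rewrite fE /q; field.
- by case: (sqr_sqrtC sqE) => sE; [left|right] => x;
    rewrite gE -?[- (sqrtC _ * _)]mulNr -sE; field.
Qed.

(** Here beta, gamma, delta are the values of the form B on (1, alpha) and
    (a, b).  Comparing coefficients gives that the star of chi is chi + c h
    with c = delta / gamma, and multiplicativity of this function forces
    c^2 h(x) h(y) = 0.  Hence sigma fixes chi and h, and (a, b) is isotropic,
    which is the sign in the conclusion. *)
Lemma sine_classified alpha g f chi h a b :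
    solution sigma alpha g f -> lin_indep g f ->
    multiplicative_fun chi -> special_sine_law chi h ->
    (forall x, g x = chi x + a * h x) ->
    (forall x, f x = alpha * chi x + b * h x) ->
  sine_family sigma alpha g f.
Proof.
move=> sol gf_indep M hM gE fE.
have [|indep det0] := @lin_indep_comb _ _ g f chi h 1 a alpha b gf_indep _ fE.
  by move=> x; rewrite mul1r.
have [z hz] := lin_indep_neq0 indep.
have [x1 x1P] := lin_indep_neq0 (lin_indepC indep).
pose beta := 1 - alpha ^+ 2; pose gamma := a - alpha * b.
pose delta := a ^+ 2 - b ^+ 2.
have B_det : beta * delta - gamma ^+ 2 != 0.
  rewrite (_ : _ - _ = - (1 * b - a * alpha) ^+ 2).
    by rewrite oppr_eq0 expf_eq0.
  by rewrite /beta /gamma /delta; ring.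
have coefs y : beta * star sigma chi y + gamma * star sigma h y
                 = beta * chi y + gamma * h y /\
               gamma * star sigma chi y = gamma * chi y + delta * h y.
  apply: (lin_indep_coef indep) => x; have := sol x y.
  rewrite !gE !fE !M !hM /star => E; apply: (eq_by_sub E).
  by rewrite /beta /gamma /delta; ring.
have gamma0 : gamma != 0.
  apply: contra_neq B_det => gamma0; have := (coefs z).2.
  rewrite gamma0 !mul0r add0r => /esym/eqP.
  by rewrite mulf_eq0 (negbTE hz) orbF => /eqP->; ring.
pose c := delta / gamma.
have star_chi x : star sigma chi x = chi x + c * h x.
  by apply: (mulfI gamma0); rewrite (coefs x).2 /c; field.
have c0 : c = 0.
  have := star_multiplicative M z z; rewrite !star_chi M hM => E.
  have /eqP : (c * h z) ^+ 2 = 0 by apply: (eq_by_sub (esym E)); ring.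
  by rewrite expf_eq0 /= mulf_eq0 (negbTE hz) orbF => /eqP.
have delta0 : delta = 0 by rewrite -(divfK gamma0 delta) -/c c0 mul0r.
have chi_even : even sigma chi.
  by apply/funext => x; rewrite star_chi c0; ring.
have h_even : even sigma h.
  apply/funext => x; apply: (mulfI gamma0); have := (coefs x).1.
  by rewrite -chi_even => /addrI.
exists chi, (fun x => b * h x); split=> //.
- by split=> // chi0; move: x1P; rewrite chi0 eqxx.
- split; first by apply/funext => x; rewrite {1}h_even.
  by move=> x y; rewrite hM; ring.
- move/eqP: delta0; rewrite subr_eq0 eqf_sqr => /orP[]/eqP aE;
    [left|right] => x; rewrite gE aE; ring.
Qed.

(** With g = a w and f = b w the equation reads
    (a - alpha b) w(x sigma(y)) = (a^2 - b^2) w(x) w(y).  If both constants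
    are non-zero, a multiple chi of w satisfies
    chi(x sigma(y)) = chi(x) chi(y), and evaluating chi(z sigma(x) sigma(y))
    in two ways shows that chi is multiplicative, hence even. *)
Lemma dependent_classified alpha g f : inhabited S ->
    solution sigma alpha g f -> ~ lin_indep g f ->
  exceptional_family alpha g f \/ regular_family sigma alpha g f.
Proof.
move=> [pt] sol /lin_dep_scalar [w [a [b [gE fE]]]].
have [sM sK] := sigma_auto.
have wE x y : (a - alpha * b) * w (x * sigma y)%g
            = (a ^+ 2 - b ^+ 2) * (w x * w y).
  by have := sol x y; rewrite !gE !fE => E; apply: (eq_by_sub E); ring.
have [fg0|fg0] := pselect (forall x, g x = 0 /\ f x = 0).
  (* q = - alpha makes the square root 1, so that the minus sign gives g = 0. *)
  right; do 2!right; left; exists (- alpha), (fun=> 1); split.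
  - split=> //; last by move=> x y; rewrite mulr1.
    by move=> /(congr1 (fun u : S -> C => u pt))/eqP; rewrite oner_eq0.
  - by move=> x; rewrite (fg0 x).2 addNr mul0r.
  - by right=> x; rewrite (fg0 x).1 sqrrN addrK sqrtC1 subrr mul0r.
have [z wz] : exists z, w z != 0.
  apply/not_existsP => w0; apply: fg0 => x.
  by have /negP/negPn/eqP wx := w0 x; rewrite gE fE wx !mulr0.
have [l0|l0] := eqVneq (a - alpha * b) 0.
  left; have /eqP := wE z z; rewrite l0 mul0r eq_sym !mulf_eq0 (negbTE wz) !orbF.
  move=> /eqP B0; have aE : a = alpha * b by apply/eqP; rewrite -subr_eq0 l0.
  have b0 : b != 0.
    by apply/eqP => b0; apply: fg0 => x; rewrite gE fE aE b0; split; ring.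
  split.
  - have /eqP : (alpha ^+ 2 - 1) * b ^+ 2 = 0.
      by apply: (eq_by_sub B0); rewrite aE; ring.
    rewrite mulf_eq0 expf_eq0 /= (negbTE b0) orbF subr_eq0.
    by rewrite sqrf_eq1 => /orP[]/eqP; [left|right].
  - move=> f0; have := congr1 (fun u => u z) f0; rewrite fE => /eqP.
    by rewrite mulf_eq0 (negbTE wz) (negbTE b0).
  - by move=> x; rewrite gE fE aE; ring.
right.
have [B0|B0] := eqVneq (a ^+ 2 - b ^+ 2) 0.
  have w_S2 x y : w (x * y)%g = 0.
    by apply: (mulfI l0); rewrite -(sK y) wE B0; ring.
  have g_S2 : vanishes_on_S2 g by move=> x y; rewrite gE w_S2 mulr0.
  have g0 : nonzero g.
    move=> g0; apply: fg0 => x.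
    have a0 : a = 0.
      have := congr1 (fun u => u z) g0; rewrite gE => /eqP.
      by rewrite mulf_eq0 (negbTE wz) orbF => /eqP.
    have b0 : b = 0.
      have /eqP : b ^+ 2 = 0 by apply: (eq_by_sub (esym B0)); rewrite a0; ring.
      by rewrite expf_eq0 => /eqP.
    by rewrite gE fE a0 b0 mul0r.
  move/eqP: B0; rewrite subr_eq0 eqf_sqr => /orP[]/eqP abE; [left|right; left].
  - split=> //; last by apply/funext => x; rewrite gE fE abE.
    by move=> alpha1; move: l0; rewrite alpha1 abE mul1r subrr eqxx.
  - split=> //; last by move=> x; rewrite gE fE abE; ring.
    by move=> alpha1; move: l0; rewrite alpha1 abE mulN1r subrr eqxx.
do 2!right; left.
pose k := (a ^+ 2 - b ^+ 2) / (a - alpha * b).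
have k0 : k != 0 by rewrite mulf_neq0 // invr_eq0.
pose chi x := k * w x.
have chiE x y : chi (x * sigma y)%g = chi x * chi y.
  have -> : chi (x * sigma y)%g
      = k / (a - alpha * b) * ((a - alpha * b) * w (x * sigma y)%g).
    by rewrite /chi; field.
  by rewrite wE /chi /k; field.
have chiz : chi z != 0 by rewrite mulf_neq0.
have chiM : multiplicative_fun chi.
  move=> x y; apply: (mulfI chiz).
  by rewrite -chiE sM mulgA !chiE [RHS]mulrA.
have chi_even : even sigma chi.
  by apply/funext => x; apply: (mulfI chiz); rewrite -chiE chiM.
pose a' := a / k; pose b' := b / k.
have abE : (a' *+ 2 - 1) ^+ 2 = 1 + (b' *+ 2 - alpha) ^+ 2 - alpha ^+ 2.
  have : (a - alpha * b) * k = a ^+ 2 - b ^+ 2 by rewrite mulrC divfK.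
  move=> /(congr1 (fun t => 4 * t / k ^+ 2)) E.
  by apply: (eq_by_sub (esym E)); rewrite /a' /b'; field.
exists (b' *+ 2 - alpha), chi; split.
- by split=> // chi0; move: chiz; rewrite chi0 eqxx.
- by move=> x; rewrite fE /chi /b'; field.
- case: (sqr_sqrtC abE) => sE; [left|right] => x;
    by rewrite gE -?[- (sqrtC _ * _)]mulNr -sE /chi /a'; field.
Qed.

Lemma solution_classified alpha g f : inhabited S ->
    solution sigma alpha g f ->
  exceptional_family alpha g f \/ regular_family sigma alpha g f.
Proof.
move=> Sne sol; have [indep|] := pselect (lin_indep g f); last first.
  exact: dependent_classified.
right.
have [chi [h [mu [a [b [M hM gE fE]]]]]] :=
  independent_solution sigma_auto sol indep.
have [mu0|mu0] := eqVneq mu 0.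
  do 5!right; left; apply: (@sine_classified _ _ _ chi h a b) => // x y.
  by rewrite hM mu0; ring.
apply: (@two_characters_classified _ _ _ (fun x => chi x + mu * h x) chi
  (a / mu) (b / mu)) => // [x y|x|x].
- by rewrite M hM; ring.
- by rewrite gE; field.
- by rewrite fE; field.
Qed.

End Classification.

(** * The families are abelian solutions *)

Section Converse.
Variables (C : numClosedFieldType) (S : semigroupType) (sigma : S -> S).
Implicit Types (f g h chi : S -> C) (alpha : C).

Lemma evenE f x : even sigma f -> f (sigma x) = f x.
Proof. by move=> f_even; rewrite [in RHS]f_even. Qed.

Lemma exceptional_solution alpha g f :
  exceptional_family alpha g f -> solution sigma alpha g f.
Proof. by move=> [[] -> _ gE] x y; rewrite !gE; ring. Qed.

Lemma one_character_solution alpha g f :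
  one_character_family sigma alpha g f -> solution sigma alpha g f.
Proof.
move=> [q [chi [[_ chi_even chiM] fE gE]]] x y.
have sE := sqrtCK (1 + q ^+ 2 - alpha ^+ 2).
by case: gE => gE; rewrite !gE !fE chiM (evenE _ chi_even);
  apply: (eq_by_sub (congr1 (fun t => - (t * (chi x * chi y) / 4)) sE));
  rewrite /=; field.
Qed.

Lemma two_character_solution alpha g f :
  two_character_family sigma alpha g f -> solution sigma alpha g f.
Proof.
move=> [q [chi1 [chi2 [[[_ even1 M1] [_ even2 M2]] _ _ fE gE]]]] x y.
have sE := sqrtCK (1 + q ^+ 2 - alpha ^+ 2).
by case: gE => gE; rewrite !gE !fE M1 M2 (evenE _ even1) (evenE _ even2);
  apply: (eq_by_sub (congr1 (fun t => - (t *
    (chi1 x - chi2 x) * (chi1 y - chi2 y) / 4)) sE)); rewrite /=; field.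
Qed.

Lemma separate_character_solution alpha g f :
  separate_character_family sigma alpha g f -> solution sigma alpha g f.
Proof.
move=> [chi1 [chi2 [_ [[_ even1 M1] [_ even2 M2]] _ fE ->]]] x y.
by rewrite !fE M1 M2 (evenE _ even1) (evenE _ even2); ring.
Qed.

Lemma sine_solution alpha g f :
  sine_family sigma alpha g f -> solution sigma alpha g f.
Proof.
move=> [chi [h [[_ chi_even chiM] [h_even hM] fE gE]]] x y.
by case: gE => gE; rewrite !gE !fE hM chiM (evenE _ chi_even) (evenE _ h_even);
  ring.
Qed.

Lemma conjugate_character_solution alpha g f :
  involutive_automorphism sigma ->
  conjugate_character_family sigma alpha g f -> solution sigma alpha g f.
Proof.
move=> [sM sK] [chi [_ M _ fE gE]] x y.
by rewrite !gE !fE /star sM sK !M; field.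
Qed.

Lemma regular_solution alpha g f : involutive_automorphism sigma ->
  regular_family sigma alpha g f -> solution sigma alpha g f.
Proof.
move=> sigma_auto [|[|[|[|[|[|]]]]]].
- by move=> [_ -> _ g0] x y; rewrite g0; ring.
- by move=> [_ fE _ g0] x y; rewrite !fE g0; ring.
- exact: one_character_solution.
- exact: two_character_solution.
- exact: separate_character_solution.
- exact: sine_solution.
- exact: conjugate_character_solution.
Qed.

Lemma multiplicative_abelian chi : multiplicative_fun chi -> abelian_fun chi.
Proof. by move=> M; split=> [x y|x y z]; rewrite !M; ring. Qed.

Lemma sine_abelian chi h :
  multiplicative_fun chi -> special_sine_law chi h -> abelian_fun h.
Proof. by move=> M hM; split=> [x y|x y z]; rewrite !hM ?M; ring. Qed.

Lemma vanishing_abelian f : vanishes_on_S2 f -> abelian_fun f.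
Proof. by move=> f0; split=> [x y|x y z]; rewrite !f0. Qed.

Lemma abelian_comb (u v : S -> C) a b : abelian_fun u -> abelian_fun v ->
  abelian_fun (fun x => a * u x + b * v x).
Proof.
move=> [uC uA] [vC vA].
by split=> [x y|x y z]; [rewrite uC vC | rewrite uA vA].
Qed.

Lemma regular_abelian alpha g f : involutive_automorphism sigma ->
  regular_family sigma alpha g f -> abelian_fun g /\ abelian_fun f.
Proof.
move=> sigma_auto.
have span (u v f' : S -> C) a b : abelian_fun u -> abelian_fun v ->
    (forall x, f' x = a * u x + b * v x) -> abelian_fun f'.
  by move=> uA vA fE; rewrite (funext fE); apply: abelian_comb.
have char_abelian chi : even_character sigma chi -> abelian_fun chi.
  by move=> [_ _ /multiplicative_abelian].
move=> [|[|[|[|[|[|]]]]]].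
- by move=> [_ -> _ /vanishing_abelian].
- move=> [_ fE _ /vanishing_abelian gA]; split=> //.
  by apply: (span g g f (-1) 0) => // x; rewrite fE; ring.
- move=> [q [chi [/char_abelian chiA fE gE]]].
  by split; [case: gE => gE|]; apply: (span chi chi _ _ 0) => // x;
    rewrite ?gE ?fE mul0r addr0 mulrCA mulrC.
- move=> [q [chi1 [chi2 [[/char_abelian A1 /char_abelian A2] _ _ fE gE]]]].
  have add_sub c d x : c * ((chi1 x + chi2 x) / 2) + d * ((chi1 x - chi2 x) / 2)
      = (c + d) / 2 * chi1 x + (c - d) / 2 * chi2 x by field.
  split; [case: gE => gE|]; apply: (span chi1 chi2 _ _ _ A1 A2) => x.
  + by rewrite gE -[X in X + _]mul1r add_sub.
  + by rewrite gE -[X in X + _]mul1r -[- (sqrtC _ * _)]mulNr add_sub.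
  + by rewrite fE add_sub.
- move=> [chi1 [chi2 [_ [/char_abelian A1 /char_abelian A2] _ fE ->]]].
  by split=> //; apply: (span chi1 chi1 f alpha 0) => // x; rewrite fE; ring.
- move=> [chi [h [[_ _ M] [_ hM] fE gE]]].
  have chiA := multiplicative_abelian M; have hA := sine_abelian M hM.
  split; first case: gE => gE.
  + by apply: (span chi h g 1 1) => // x; rewrite gE; ring.
  + by apply: (span chi h g 1 (-1)) => // x; rewrite gE; ring.
  + by apply: (span chi h f alpha 1) => // x; rewrite fE; ring.
- move=> [chi [_ M _ fE gE]].
  have starM := multiplicative_abelian (star_multiplicative sigma_auto M).
  have chiA := multiplicative_abelian M.
  split; first by apply: (span _ _ _ _ _ chiA starM) => x; rewrite gE.
  by apply: (span _ _ _ _ (- ((1 - alpha) / 2)) chiA starM) => x; rewrite fE mulNr.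
Qed.

End Converse.

(** * Continuity *)

Lemma continuous_comb (K : numFieldType) (T : topologicalType) (u v : T -> K) (a b : K) :
  continuous u -> continuous v -> continuous (fun x => a * u x + b * v x).
Proof.
move=> uc vc x; apply: cvgD; apply: cvgM;
  [exact: cvg_cst|exact: uc|exact: cvg_cst|exact: vc].
Qed.

Section Continuity.
Variables (C : numClosedFieldType) (S : topSemigroupType).
Implicit Types (f g h chi u v : S -> C).

Lemma continuous_right_translate f y :
  continuous f -> continuous (fun x => f (x * y)%g).
Proof.
move=> fc x; apply: (@continuous_comp _ _ _ (fun x => x * y)%g f); last exact: fc.
apply: (@continuous_comp _ _ _ (fun x => (x, y)) (fun p : S * S => p.1 * p.2)%g).
  by apply: cvg_pair; [exact: cvg_id | exact: cvg_cst].
exact: mulg_continuous.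
Qed.

Lemma continuous_scale_eq u v c : c != 0 ->
  (forall x, u x = c * v x) -> continuous u -> continuous v.
Proof.
move=> c0 uE uc.
rewrite (_ : v = fun x => c^-1 * u x + 0 * u x); first exact: continuous_comb.
by apply/funext => x; rewrite uE mul0r addr0 mulKf.
Qed.

(** f (x y) - chi2 y f x = a (chi1 y - chi2 y) chi1 x, and y can be chosen such
    that the factor on the right does not vanish. *)
Lemma continuous_character_of_comb f chi1 chi2 a b :
    multiplicative_fun chi1 -> multiplicative_fun chi2 -> chi1 <> chi2 ->
    a != 0 -> (forall x, f x = a * chi1 x + b * chi2 x) ->
  continuous f -> continuous chi1.
Proof.
move=> M1 M2 chi12 a0 fE fc.
have [y chiy] : exists y, chi1 y != chi2 y.
  apply/not_existsP => eq12; apply: chi12; apply/funext => y.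
  by have /negP/negPn/eqP := eq12 y.
apply: (@continuous_scale_eq (fun x => 1 * f (x * y)%g + (- chi2 y) * f x) _
  (a * (chi1 y - chi2 y))).
- by rewrite mulf_neq0 ?subr_eq0.
- by move=> x; rewrite !fE M1 M2; ring.
- by apply: continuous_comb => //; apply: continuous_right_translate.
Qed.

Lemma continuous_solution (sigma : S -> S) alpha g f :
    inhabited S -> involutive_automorphism sigma ->
    solution sigma alpha g f -> continuous f ->
    (forall chi, multiplicative_fun chi -> continuous chi ->
      f <> (fun x => alpha * chi x)) ->
  continuous g.
Proof.
move=> Sne sigma_auto sol fc not_char.
have f0 : f <> (fun=> 0).
  move=> f0; apply: (not_char (fun=> 0)) => [x y||].
  - by rewrite mulr0.
  - exact: cst_continuous.
  - by apply/funext => x; rewrite f0 mulr0.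
have half_neq0 (t : C) : t <> 0 -> t / 2 != 0.
  by move=> /eqP t0; rewrite mulf_neq0 // invr_eq0 pnatr_eq0.
have comb u v a b : continuous u -> continuous v ->
    (forall x, g x = a * u x + b * v x) -> continuous g.
  by move=> uc vc gE; rewrite (funext gE); apply: continuous_comb.
have := solution_classified sigma_auto Sne sol.
move=> [[_ _ gE]|[|[|[|[|[|[|]]]]]]].
- by apply: (comb f f alpha 0) => // x; rewrite gE; ring.
- by move=> [_ <-].
- move=> [_ fE _ _].
  by apply: (comb f f (-1) 0) => // x; rewrite fE; ring.
- move=> [q [chi [_ fE gE]]].
  have qa : q + alpha != 0.
    apply/eqP => qa; apply: f0; apply/funext => x.
    by rewrite fE qa mul0r.
  have chi_c : continuous chi.
    apply: (@continuous_scale_eq f chi ((q + alpha) / 2)) => //.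
      by rewrite mulf_neq0 // invr_eq0 pnatr_eq0.
    by move=> x; rewrite fE mulrCA mulrC.
  by case: gE => gE; apply: (comb chi chi _ 0) => // x;
    rewrite gE mul0r addr0 mulrCA mulrC.
- move=> [q [chi1 [chi2 [[[_ _ M1] [_ _ M2]] chi12 [qa qNa] fE gE]]]].
  have fE1 x : f x = (alpha + q) / 2 * chi1 x + (alpha - q) / 2 * chi2 x.
    by rewrite fE; field.
  have fE2 x : f x = (alpha - q) / 2 * chi2 x + (alpha + q) / 2 * chi1 x.
    by rewrite fE1 addrC.
  have c1 : continuous chi1.
    apply: (continuous_character_of_comb M1 M2 chi12 _ fE1 fc).
    by apply: half_neq0 => /eqP; rewrite addrC addr_eq0 => /eqP.
  have c2 : continuous chi2.
    apply: (continuous_character_of_comb M2 M1 (nesym chi12) _ fE2 fc).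
    by apply: half_neq0 => /eqP; rewrite subr_eq0 eq_sym => /eqP.
  pose s := sqrtC (1 + q ^+ 2 - alpha ^+ 2).
  by case: gE => gE;
    [apply: (comb _ _ ((1 + s) / 2) ((1 - s) / 2) c1 c2)
    |apply: (comb _ _ ((1 - s) / 2) ((1 + s) / 2) c1 c2)] => x;
    rewrite gE -/s; field.
- move=> [chi1 [chi2 [/eqP alpha0 [[_ _ M1] _] _ fE _]]].
  case: (not_char chi1 M1 _ (funext fE)).
  exact: continuous_scale_eq alpha0 fE fc.
- move=> [chi [h [[_ _ M] [_ hM] fE gE]]].
  have [y hy] : exists y, h y != 0.
    apply/not_existsP => h0; have fE0 x : f x = alpha * chi x.
      by rewrite fE; have /negP/negPn/eqP-> := h0 x; rewrite addr0.
    apply: (not_char chi M _ (funext fE0)).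
    apply: (continuous_scale_eq _ fE0 fc); apply/eqP => alpha0; apply: f0.
    by apply/funext => x; rewrite fE0 alpha0 mul0r.
  (* f (x y) = chi y f x + h y chi x, which can be solved for chi x. *)
  have chi_c : continuous chi.
    apply: (@continuous_scale_eq (fun x => 1 * f (x * y)%g + (- chi y) * f x) _
      (h y)) => //.
      by move=> x; rewrite !fE M hM; ring.
    by apply: continuous_comb => //; apply: continuous_right_translate.
  by case: gE => gE;
    [apply: (comb f chi 1 (1 - alpha))|apply: (comb f chi (-1) (1 + alpha))] => // x;
    rewrite gE fE; ring.
- move=> [chi [[alpha1 alphaN1] M chi_neq fE gE]].
  have M' := star_multiplicative sigma_auto M.
  have c1 : continuous chi.
    apply: (@continuous_character_of_comb f chi (star sigma chi) ((1 + alpha) / 2)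
      (- ((1 - alpha) / 2))) => //.
      by apply: half_neq0 => /eqP; rewrite addrC addr_eq0 => /eqP.
    by move=> x; rewrite fE mulNr.
  have c2 : continuous (star sigma chi).
    apply: (@continuous_character_of_comb f (star sigma chi) chi
      (- ((1 - alpha) / 2)) ((1 + alpha) / 2)) => //.
    - exact: nesym.
    - by rewrite oppr_eq0; apply: half_neq0 => /eqP; rewrite subr_eq0 eq_sym => /eqP.
    - by move=> x; rewrite fE mulNr addrC.
  by apply: (comb _ _ _ _ c1 c2) => x; rewrite gE.
Qed.

End Continuity.

Theorem theorem3p4 (R : realType) (alpha : Cplx R) :
  (forall (S : semigroupType) (sigma : S -> S) (g f : S -> Cplx R),
      inhabited S -> involutive_automorphism sigma ->
      (solution sigma alpha g f <->
         exceptional_family alpha g f \/ regular_family sigma alpha g f) /\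
      (regular_family sigma alpha g f -> abelian_fun g /\ abelian_fun f)) /\
  (forall (S : topSemigroupType) (sigma : S -> S) (g f : S -> Cplx R),
      inhabited S -> involutive_automorphism sigma ->
      solution sigma alpha g f ->
      continuous f ->
      (forall chi : S -> Cplx R, multiplicative_fun chi -> continuous chi ->
         f <> (fun x => alpha * chi x)) ->
      continuous g).
Proof.
split=> S sigma g f Sne sigma_auto; last exact: continuous_solution.
split; last exact: regular_abelian.
split; first exact: solution_classified.
by case; [exact: exceptional_solution|exact: regular_solution].
Qed.
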